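(* Let $X$ be a separable metric space and let $\mu:\mathcal{B}(X)\to[0,1]$ be an atomless strictly positive Borel probability measure. Let $A\subseteq B\subseteq C\subseteq X$ be sets such that $A$ is an $F_\sigma$-set, and $B,C$ are closed sets such that: (i) $\mu(B)>0$; (ii) the set $S$ of isolated points of $B$ is contained in $A$; and (iii) $B\setminus S$ is regular closed. Then there exists a sequence $x$ taking values in $X$ such that $$\Lambda_x=A,\quad \Gamma_x=B,\quad\text{and}\quad \mathrm{L}_x=C.$$
   Context: $\mathbf{N}$ denotes the positive integers. Let $\mathcal{I}_0$ be the ideal of sets of zero asymptotic density, $\mathcal{I}_0:=\{T\subseteq\mathbf{N}:\lim_{n\to\infty}|T\cap\{1,\ldots,n\}|/n=0\}$. For a sequence $x=(x_n)_{n\in\mathbf{N}}$ in $X$: $\Lambda_x$ (the statistical limit points) is the set of all $\ell\in X$ such that $\lim_{k\to\infty}x_{n_k}=\ell$ for some subsequence $(x_{n_k})$ with $\{n_k:k\in\mathbf{N}\}\notin\mathcal{I}_0$. $\Gamma_x$ (the statistical cluster points) is the set of all $\ell\in X$ such that $\{n:x_n\in U\}\notin\mathcal{I}_0$ for every neighborhood $U$ of $\ell$. $\mathrm{L}_x$ (the ordinary limit points) is the set of all limits of convergent subsequences of $x$. $\mathcal{B}(X)$ is the Borel $\sigma$-algebra of $X$. A Borel probability measure $\mu$ is strictly positive if $\mu(U)>0$ for all non-empty open sets $U$; it is atomless if for each measurable $E$ with $\mu(E)>0$ there is a measurable $E'\subseteq E$ with $0<\mu(E')<\mu(E)$. A set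 $R\subseteq X$ is regular closed if it equals the closure of its interior. *)

(* Defs.v *)
From HB Require Import structures.
From mathcomp Require Import all_boot all_order all_algebra.
From mathcomp Require Import all_classical all_reals all_analysis.
From mathcomp Require Import borel_hierarchy.

Set Implicit Arguments.
Unset Strict Implicit.
Unset Printing Implicit Defensive.

Import Order.TTheory GRing.Theory Num.Theory.
Import numFieldNormedType.Exports.

Local Open Scope classical_set_scope.
Local Open Scope ring_scope.

(* [measurableType] requires a pointed carrier, which [metricType] does not
   provide.  Since no probability measure exists on the empty space, asking for
   a point is no restriction below. *)
#[short(type="pmetricType")]
HB.structure Definition PointedMetric (K : numDomainType) :=
  {M of Pointed M & Metric K M}.

Definition separable (X : topologicalType) : Prop :=
  exists2 D : set X, countable D & dense D.

(* X equipped with its Borel sigma-algebra *)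
Notation borel X := (g_sigma_algebraType (@open X)).

Definition strictly_positive (R : realType) (X : ptopologicalType)
    (mu : set (borel X) -> \bar R) : Prop :=
  forall U : set X, open U -> U !=set0 -> (0 < mu U)%E.

Definition atomless (d : measure_display) (T : measurableType d)
    (R : realType) (mu : set T -> \bar R) : Prop :=
  forall E : set T, measurable E -> (0 < mu E)%E ->
    exists E' : set T, [/\ measurable E', E' `<=` E & (0 < mu E' < mu E)%E].

(* Index sets are sets of positive integers, as in |T ∩ {1, ..., n}| / n, so
   a sequence x : nat -> X stands for (x 1, x 2, ...) and x 0 plays no role. *)
Definition zero_density (R : realType) (T : set nat) : Prop :=
  (fun n : nat => (\sum_(1 <= i < n.+1) (i \in T : nat))%N%:R / n%:R : R)
    @ \oo --> (0 : R).

Definition subsequence_index (u : nat -> nat) : Prop :=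
  (0 < u 0)%N /\ {homo u : i j / (i < j)%N}.

Section limit_sets.
Variables (R : realType) (X : topologicalType) (x : nat -> X).

Definition stat_limit_points : set X := [set l |
  exists u : nat -> nat, [/\ subsequence_index u, x \o u @ \oo --> l &
    ~ zero_density R (range u)]].

Definition stat_cluster_points : set X := [set l |
  forall U : set X, nbhs l U ->
    ~ zero_density R [set n : nat | (0 < n)%N /\ U (x n)]].

Definition limit_points : set X := [set l |
  exists u : nat -> nat, subsequence_index u /\ (x \o u @ \oo --> l)].

End limit_sets.

(* Main.v *)
(* Write n > 0 as 2^j (2m + 1), so that the integers with a given j have density
   2^-(j+1). A set that meets each of these classes in zero density has zero
   density, so the classes can be filled independently.

   For A = \bigcup_i F_i with F_i closed, one class carries a sequence that is
   constant on the dyadic blocks of m and runs through a dense sequence of F_i,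
   each term recurring infinitely often: its statistical limit points are those
   of F_i. To reach the remaining points of B, take a dense sequence in the
   interior V of B minus its isolated points. Around each of its terms e, split a
   ball repeatedly into two smaller balls at positive distance, and let the residue
   of m mod 2^K select a ball of level K. Any point has a neighborhood meeting at
   most one ball of level K, hence visited with density at most 2^-K: there are no
   statistical limit points, whereas e is a statistical cluster point. The values
   with m = 0 sit on the powers of 2 and run through a dense sequence of C.

   The measure is used only through its null singletons: as nonempty open sets
   have positive measure, no point of X is
   isolated, and B, which has positive measure, does not consist of its
   (countably many) isolated points. *)

Require Import Defs.
From HB Require Import structures.
From mathcomp Require Import all_boot all_order all_algebra.
From mathcomp Require Import all_classical all_reals all_analysis.
From mathcomp Require Import borel_hierarchy.
From mathcomp Require Import zify lra.

Set Implicit Arguments.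
Unset Strict Implicit.
Unset Printing Implicit Defensive.

Import Order.TTheory GRing.Theory Num.Theory.
Import numFieldNormedType.Exports.

Local Open Scope classical_set_scope.
Local Open Scope ring_scope.

(** * Counting functions and the ideal of sets of zero density *)

Definition counting_upto (T : set nat) (n : nat) : nat :=
  \sum_(1 <= i < n.+1) (i \in T : nat).

(** An integer [k] replaces the inverse of epsilon, so density estimates become inequalities in
    [nat]. *)
Lemma zero_densityP (R : realType) (T : set nat) :
  zero_density R T <->
  forall k, exists N, forall n, (N <= n -> k * counting_upto T n <= n)%N.
Proof.
rewrite /zero_density; split=> [/cvgrPdist_le T0 k|T0].
- have [|N _ TN] := T0 k.+1%:R^-1; first by rewrite invr_gt0 ltr0n.
  exists N.+1 => n Nn; have n0 : (0 : R) < n%:R by rewrite ltr0n; lia.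
  have := TN n (ltnW Nn).
  rewrite sub0r normrN ger0_norm ?divr_ge0// ler_pdivrMr// mulrC.
  rewrite ler_pdivlMr ?ltr0n// -natrM ler_nat -/(counting_upto T n); lia.
- apply/cvgrPdist_le => /= e e0.
  have [N TN] := T0 (Num.bound e^-1).
  exists N.+1 => // n /= Nn; have n0 : (0 : R) < n%:R by rewrite ltr0n; lia.
  rewrite sub0r normrN ger0_norm ?divr_ge0// ler_pdivrMr//.
  rewrite -ler_pdivrMl//.
  apply: (@le_trans _ _ (Num.bound e^-1 * counting_upto T n)%N%:R).
    by rewrite natrM ler_wpM2r// ltW// archi_boundP// invr_ge0 ltW.
  by rewrite ler_nat TN// ltnW.
Qed.

Lemma counting_uptoE (T : set nat) (n : nat) :
  counting_upto T n = size [seq i <- index_iota 1 n.+1 | i \in T].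
Proof. by rewrite size_filter -sum1_count big_mkcond. Qed.

Lemma counting_upto_le (T : set nat) (n s : nat) (f : nat -> nat) :
  (forall i, T i -> 0 < i <= n -> f i < s)%N ->
  (forall i j, T i -> T j -> f i = f j -> i = j) ->
  (counting_upto T n <= s)%N.
Proof.
move=> fs finj; rewrite counting_uptoE -(size_map f) -[leqRHS](size_iota 0).
apply: uniq_leq_size.
  rewrite map_inj_in_uniq ?filter_uniq ?iota_uniq// => i j.
  rewrite !mem_filter => /andP[/set_mem Ti _] /andP[/set_mem Tj _].
  exact: finj.
move=> _ /mapP[i + ->]; rewrite mem_filter mem_index_iota ltnS.
by move=> /andP[/set_mem Ti i1n]; rewrite mem_iota fs.
Qed.

Lemma counting_upto_ge (T : set nat) (n a s : nat) (f : nat -> nat) :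
  injective f ->
  (forall t, a <= t < a + s -> T (f t) /\ 0 < f t <= n)%N ->
  (s <= counting_upto T n)%N.
Proof.
move=> finj fT; rewrite counting_uptoE -[leqLHS](size_iota a) -(size_map f).
apply: uniq_leq_size; first by rewrite map_inj_uniq// iota_uniq.
move=> _ /mapP[t + ->]; rewrite mem_iota => /fT[Tt tn].
by rewrite mem_filter mem_index_iota ltnS tn andbT; apply/mem_set.
Qed.

Section zero_density_ideal.
Variable R : realType.
Implicit Types T : set nat.

Lemma zero_densityS T T' : (forall n, (0 < n)%N -> T n -> T' n) ->
  zero_density R T' -> zero_density R T.
Proof.
move=> TT' /zero_densityP zT'; apply/zero_densityP => k.
have [N TN] := zT' k; exists N => n /TN; apply: leq_trans.
rewrite leq_mul2l; apply/orP; right; rewrite /counting_upto !big_nat.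
apply: leq_sum => i /andP[i0 _].
by case: (boolP (i \in T)) => // /set_mem /(TT' _ i0) /mem_set ->.
Qed.

Lemma zero_densityU T T' : zero_density R T -> zero_density R T' ->
  zero_density R (T `|` T').
Proof.
move=> /zero_densityP zT /zero_densityP zT'; apply/zero_densityP => k.
have [[N TN] [N' TN']] := (zT (2 * k)%N, zT' (2 * k)%N).
exists (maxn N N') => n; rewrite geq_max => /andP[/TN Tn /TN' Tn'].
suff : (counting_upto (T `|` T') n <=
        counting_upto T n + counting_upto T' n)%N.
  by nia.
rewrite -big_split; apply: leq_sum => i _ /=.
by rewrite in_setU; case: (i \in T).
Qed.

Lemma zero_density_bounded T (N : nat) :
  (forall n, T n -> (n < N)%N) -> zero_density R T.
Proof.
move=> TN; apply/zero_densityP => k; exists (k * N)%N => n; apply: leq_trans.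
rewrite leq_mul2l (counting_upto_le (f := id)) ?orbT// => i Ti _.
exact: TN.
Qed.

Lemma zero_density_bigcup (k : nat) (F : nat -> set nat) :
  (forall j, zero_density R (F j)) ->
  zero_density R (\bigcup_(j in `I_k) F j).
Proof.
move=> zF; elim: k => [|k IH].
  by rewrite II0 bigcup_set0; exact: (@zero_density_bounded _ 0).
apply: zero_densityS (zero_densityU IH (zF k)) => n _ [j /= jk Fj].
by case: (ltngtP j k) => [?|?|<-]; [left; exists j|lia|right].
Qed.

(** For each [K] the residue class bounds the upper density of [T] by 2^-K. *)
Lemma zero_density_approx T :
  (forall K, exists r T1, zero_density R T1 /\
     T `<=` T1 `|` [set n | n = r %[mod 2 ^ K]]%N) ->
  zero_density R T.
Proof.
(* As 2^(4k) > 4k, the residue class contributes at most n/4 + k to [k] times the count, and [T1] at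
   most n/2; [n >= 4 * k] absorbs the extra [k]. *)
move=> Tr; apply/zero_densityP => k; have [r [T1 [zT1 TT1]]] := Tr (4 * k)%N.
have zU : forall n, (counting_upto (T `&` ~` T1) n <= n %/ 2 ^ (4 * k) + 1)%N.
  move=> n; apply: (@counting_upto_le _ _ _ (fun i => i %/ 2 ^ (4 * k))%N).
    by move=> i _ /andP[_ ?]; rewrite addn1 ltnS leq_div2r.
  move=> i j [/TT1[]//ir _] [/TT1[]//jr _] e.
  by rewrite (divn_eq i (2 ^ (4 * k))) (divn_eq j (2 ^ (4 * k))) e ir jr.
have /zero_densityP/(_ (2 * k)%N)[N T1N] := zT1.
exists (N + 4 * k)%N => n Nn; have := T1N n (leq_trans (leq_addr _ _) Nn).
have := zU n.
have : (counting_upto T n <=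
        counting_upto T1 n + counting_upto (T `&` ~` T1) n)%N.
  rewrite -big_split; apply: leq_sum => i _ /=.
  by rewrite in_setI in_setC; case: (i \in T); case: (i \in T1).
have : (n %/ 2 ^ (4 * k) * (4 * k) <= n)%N.
  rewrite (leq_trans _ (leq_trunc_div n (2 ^ (4 * k))))// leq_mul2l.
  by rewrite (ltnW (ltn_expl _ _)) ?orbT.
nia.
Qed.

(** Integers of valuation at least [K] form a single residue class modulo 2^K; the others lie in [K]
    pieces of zero density. *)
Lemma zero_density_split T :
  (forall j, zero_density R (T `&` [set n | logn 2 n = j])) ->
  zero_density R T.
Proof.
move=> zT; apply: zero_density_approx => K.
exists 0%N, (\bigcup_(j in `I_K) (T `&` [set n | logn 2 n = j])); split.
  exact: zero_density_bigcup.
move=> n Tn; case: (ltnP (logn 2 n) K) => nK.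
  by left; exists (logn 2 n).
right => /=; rewrite mod0n; apply/eqP; apply: dvdn_trans (pfactor_dvdnn 2 n).
exact: dvdn_exp2l.
Qed.

(** The [s] integers [D * t + c] are at most [2 * s * D]: a proportion 1/(2D), for arbitrarily large
    [s]. *)
Lemma not_zero_density T (D c : nat) : (0 < c <= D)%N ->
  (forall N, exists2 s, (N <= s)%N &
     forall t, (s <= t < 2 * s)%N -> T (D * t + c)%N) ->
  ~ zero_density R T.
Proof.
move=> /andP[c0 cD] Ts /zero_densityP/(_ (4 * D)%N)[N TN].
have [s Ns sT] := Ts N.+1.
have sn : (s <= counting_upto T (2 * s * D))%N.
  apply: (@counting_upto_ge _ _ s s (fun t => D * t + c)%N) => [t t' /=|t ts].
    nia.
  by split; [apply: sT; lia|nia].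
have := TN (2 * s * D)%N; nia.
Qed.

End zero_density_ideal.

(** * Coordinates n = 2^j (2m + 1) on the positive integers *)

Lemma logn_expM_odd (j m : nat) : logn 2 (2 ^ j * (2 * m).+1) = j.
Proof.
rewrite lognM ?expn_gt0// pfactorK// [X in (_ + X)%N]lognE dvdn2 /= oddM.
by rewrite addn0.
Qed.

Definition dyadic (j m : nat) : nat := (2 ^ j.+1 * m + 2 ^ j)%N.

Lemma logn_dyadic (j m : nat) : logn 2 (dyadic j m) = j.
Proof.
rewrite /dyadic (_ : _ + _ = 2 ^ j * (2 * m).+1)%N; last by rewrite expnS; lia.
exact: logn_expM_odd.
Qed.

Lemma divn_dyadic (j m : nat) : (dyadic j m %/ 2 ^ j.+1)%N = m.
Proof.
rewrite /dyadic mulnC divnMDl ?expn_gt0// divn_small ?addn0//.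
by rewrite ltn_exp2l.
Qed.

Lemma dyadicK (n : nat) : (0 < n)%N ->
  dyadic (logn 2 n) (n %/ 2 ^ (logn 2 n).+1) = n.
Proof.
move=> n0; have [m] := pfactor_coprime (isT : prime 2) n0.
rewrite coprime2n => m2 nE; set l := logn 2 n in nE *.
suff -> : n = dyadic l m./2 by rewrite divn_dyadic.
rewrite [LHS]nE -(odd_double_half m) m2 /dyadic expnS; nia.
Qed.

Lemma dyadic_mono (j m m' : nat) : (m < m')%N -> (dyadic j m < dyadic j m')%N.
Proof. by move=> mm'; rewrite /dyadic ltn_add2r ltn_pmul2l ?expn_gt0. Qed.

Lemma dyadic_gt0 (j m : nat) : (0 < dyadic j m)%N.
Proof. by rewrite addn_gt0 expn_gt0 orbT. Qed.

(** * Increasing index sequences *)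

Lemma enum_infinite (T : set nat) : (forall N, exists2 n, (N <= n)%N & T n) ->
  exists2 u : nat -> nat, {homo u : i j / (i < j)%N} & range u = T.
Proof.
move=> Tinf.
have /choice[next nextP] : forall N, exists k, [/\ (N <= k)%N, T k &
    forall n, (N <= n)%N -> T n -> (k <= n)%N].
  move=> N.
  have [|n [[Nn Tn] nmin]] := @nat_has_minimum [set n | (N <= n)%N /\ T n].
    by have [n] := Tinf N; exists n.
  by exists n; split=> // k Nk Tk; exact: nmin.
pose u := fix u i := if i is i'.+1 then next (u i').+1 else next 0%N.
have uS i : (u i < u i.+1)%N by have [] := nextP (u i).+1.
have uT i : T (u i).
  by case: i => [|i]; [have [] := nextP 0%N|have [] := nextP (u i).+1].
exists u; first exact: homo_ltn ltn_trans uS.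
apply/seteqP; split=> [_ [i _ <-]//|t Tt].
suff tu i : (t < u i)%N -> range u t.
  apply: (tu t.+1); elim: t {Tt tu} => [|t IH].
    exact: leq_ltn_trans (uS 0%N).
  exact: leq_ltn_trans IH (uS _).
elim: i => [|i IH] ti.
  by have [_ _ /(_ t isT Tt)] := nextP 0%N; rewrite leqNgt ti.
case: (ltngtP t (u i)) => [//|uit|->]; last by exists i.
by have [_ _ /(_ t uit Tt)] := nextP (u i).+1; rewrite leqNgt -/(u i.+1) ti.
Qed.

Lemma extract_increasing (P : nat -> nat -> Prop) :
  (forall i N, exists2 k, (N <= k)%N & P i k) ->
  exists2 u : nat -> nat, {homo u : i j / (i < j)%N} & forall i, P i (u i).
Proof.
move=> Pinf.
pose next i N := sval (cid2 (Pinf i N)).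
have nextP i N : (N <= next i N)%N /\ P i (next i N).
  by rewrite /next; case: cid2.
pose u := fix u i := if i is i'.+1 then next i (u i').+1 else next 0%N 0%N.
have uS i : (u i < u i.+1)%N by have [] := nextP i.+1 (u i).+1.
exists u; first exact: homo_ltn ltn_trans uS.
by case=> [|i]; [have [] := nextP 0%N 0%N|have [] := nextP i.+1 (u i).+1].
Qed.

Lemma homo_ltn_ge_id (u : nat -> nat) : {homo u : i j / (i < j)%N} ->
  forall i, (i <= u i)%N.
Proof.
by move=> um; elim=> // i IH; exact: leq_ltn_trans IH (um _ _ (ltnSn i)).
Qed.

(* The type of [mdist] hides [R] behind a structure path, and [lra] then fails
   to match equal distances. *)
Definition dist {R : realType} {X : metricType R} (a b : X) : R := mdist a b.

(** * Metric preliminaries and dense sequences *)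

Section metric_sequences.
Context {R : realType} {X : metricType R}.
Implicit Types (F U V : set X) (a b c e l : X) (r : R).

Lemma dist_triangle a b c : dist a c <= dist a b + dist b c.
Proof. exact: metric_triangle. Qed.

Lemma distC a b : dist a b = dist b a.
Proof. exact: metric_sym. Qed.

Lemma dist_xx a : dist a a = 0.
Proof. exact: mdistxx. Qed.

Lemma ball_dist a r : ball a r = [set b | dist a b < r].
Proof. exact: ballEmdist. Qed.

Lemma natSinv_lt r : 0 < r -> exists N, forall n, (N <= n)%N -> n.+1%:R^-1 < r.
Proof.
by move=> r0; have [N _ Nr] := near_infty_natSinv_lt (PosNum r0); exists N.
Qed.

Lemma nbhs_distP a U :
  nbhs a U <-> exists2 r : R, 0 < r & forall b, dist a b < r -> U b.
Proof.
split=> [/nbhs_ballP[r r0 rU]|[r r0 rU]].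
  by exists r => // b ab; apply: rU; rewrite ball_dist.
by apply/nbhs_ballP; exists r => // b; rewrite ball_dist; exact: rU.
Qed.

Lemma cvg_dist_lt a (y : nat -> X) :
  (forall i, dist a (y i) < i.+1%:R^-1 :> R) -> y @ \oo --> a.
Proof.
move=> ya; apply/cvg_ballP => r r0; near=> i.
rewrite ball_dist /=; apply: lt_trans (ya i) _.
by near: i; have [N Nr] := natSinv_lt r0; exists N.
Unshelve. all: end_near. Qed.

(* [logn 2] takes every value infinitely often, which makes each term of the
   underlying dense sequence recur. *)
Lemma frequently_dense_sequence F : separable X -> F !=set0 ->
  exists q : nat -> X, (forall k, F (q k)) /\
    forall a, F a -> forall (r : R) N, 0 < r ->
      exists2 k, (N <= k)%N & dist a (q k) < r.
Proof.
move=> [D /pfcard_geP[->|[g]] dD] [a0 Fa0].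
  by have [] := dD setT; [exists a0|exact: openT|move=> ? []].
(* [D] need not meet [F], so the pair [(i, t)] asks for a point of [F] within 1/(t+1) of [g i], with
   [a0] as default. *)
pose near_g (p : nat * nat) :=
  [set b | F b /\ dist (g p.1) b < p.2.+1%:R^-1].
pose q k := if unpickle (logn 2 k) is Some p then xget a0 (near_g p) else a0.
have Fxget p : F (xget a0 (near_g p)) by case: xgetP => // b _ [].
exists q; split=> [k|a Fa r N r0]; first by rewrite /q; case: unpickle.
have r2 : 0 < r / 2 by lra.
have [t /(_ t (leqnn t)) tr] := natSinv_lt r2.
have t0 : 0 < t.+1%:R^-1 :> R by rewrite invr_gt0 ltr0n.
have [b [ab Db]] : exists b, dist a b < t.+1%:R^-1 /\ D b.
  have /dD : (ball a (t.+1%:R^-1 : R))° !=set0.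
    by exists a; apply: nbhs_singleton; exact: nbhs_interior (nbhsx_ballx _ _ t0).
  move=> /(_ (open_interior _))[b [/interior_subset + Db]].
  by rewrite ball_dist; exists b.
have [i _ gib] := @surj _ _ _ _ g b Db.
exists (2 ^ pickle (i, t) * (2 * N).+1)%N.
  by rewrite (@leq_trans (2 * N).+1)// ?leq_pmull ?expn_gt0//; lia.
rewrite /q logn_expM_odd pickleK.
have [_ ] : near_g (i, t) (xget a0 (near_g (i, t))).
  by apply: (@xgetPex _ a0 (near_g (i, t))); exists a; rewrite /near_g/= gib distC.
set z := xget _ _; rewrite /= gib => bz.
by move: tr ab bz (dist_triangle a b z); set w := t.+1%:R^-1; lra.
Qed.

(** * A binary tree of separated balls *)

Section splitting_tree.
Lemma modn_exp2S k n :
  (n %% 2 ^ k.+1 = odd (n %/ 2 ^ k) * 2 ^ k + n %% 2 ^ k)%N.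
Proof.
rewrite {1}(divn_eq (n %% 2 ^ k.+1) (2 ^ k)) modn_dvdm ?dvdn_exp2l//.
by rewrite expnS -modn_divl modn2.
Qed.

Hypothesis crowded : forall c (r : R), 0 < r ->
  exists2 c', 0 < dist c c' & dist c c' < r.

Definition sibling (s : X * R) : X :=
  xget s.1 [set c' | 0 < dist s.1 c' /\ dist s.1 c' < s.2 / 4].

(** A quarter of the old radius keeps both children inside the parent ball; a quarter of the
    distance between their centres keeps them apart. *)
Definition child (b : bool) (s : X * R) : X * R :=
  (if b then sibling s else s.1,
   Num.min (s.2 / 4) (dist s.1 (sibling s) / 4)).

(** The binary digits of [n], lowest first, choose the branch, so level [k] depends only on [n]
    modulo 2^k. *)
Fixpoint node (s : X * R) (k n : nat) : X * R :=
  if k is k'.+1 then child (odd (n %/ 2 ^ k')) (node s k' n) else s.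

Lemma nodeS s k n : node s k.+1 n = child (odd (n %/ 2 ^ k)) (node s k n).
Proof. by []. Qed.

Lemma siblingP (s : X * R) : 0 < s.2 ->
  0 < dist s.1 (sibling s) < s.2 / 4.
Proof.
move=> s0; have [|c' c1 c2] := @crowded s.1 (s.2 / 4); first by lra.
rewrite /sibling; case: xgetP => [z _ [-> ->]//|/(_ c')]; last by case.
Qed.

Lemma child_radius (b : bool) (s : X * R) : 0 < s.2 ->
  [/\ 0 < (child b s).2, (child b s).2 <= s.2 / 4 &
      (child b s).2 <= dist s.1 (sibling s) / 4].
Proof.
move=> s0; have /andP[? ?] := siblingP s0.
by rewrite /child /= lt_min !ge_min !lexx orbT; split=> //; apply/andP; split; lra.
Qed.

Lemma child_center (b : bool) (s : X * R) : 0 < s.2 ->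
  dist s.1 (child b s).1 < s.2 / 4.
Proof.
move=> s0; have /andP[? ?] := siblingP s0.
by rewrite /child; case: b => //=; rewrite dist_xx; lra.
Qed.

Lemma node_mod s k n n' : n = n' %[mod 2 ^ k] -> node s k n = node s k n'.
Proof.
elim: k n n' => //= k IH n n' nn'.
have nk : n = n' %[mod 2 ^ k].
  by rewrite -(@modn_dvdm (2 ^ k.+1) n) ?dvdn_exp2l// nn' modn_dvdm// dvdn_exp2l.
rewrite (IH _ _ nk); congr (child _ _).
have e2 i : odd (i %/ 2 ^ k) = odd (i %% 2 ^ k.+1 %/ 2 ^ k).
  rewrite {1}(divn_eq i (2 ^ k.+1)) expnS mulnA divnMDl ?expn_gt0//.
  by rewrite oddD oddM andbF.
by rewrite e2 nn' -e2.
Qed.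

Variable s : X * R.
Hypotheses (s0 : 0 < s.2) (s1 : s.2 <= 1).

Lemma node_gt0 k n : 0 < (node s k n).2.
Proof. by elim: k => //= k IH; have [] := child_radius (odd (n %/ 2 ^ k)) IH. Qed.

Lemma node_radius k n : (node s k n).2 <= k.+1%:R^-1.
Proof.
elim: k => [|k IH]; rewrite ?nodeS; first by rewrite invr1.
have [_ + _] := child_radius (odd (n %/ 2 ^ k)) (node_gt0 k n).
move=> /le_trans; apply.
rewrite (@le_trans _ _ (k.+1%:R^-1 / 4))//.
  by rewrite ler_pM2r// invr_gt0.
rewrite -invfM lef_pV2 ?posrE ?mulr_gt0// -natrM ler_nat; lia.
Qed.

Lemma node_ball k i n b : dist (node s (k + i) n).1 b < (node s (k + i) n).2 ->
  dist (node s k n).1 b < (node s k n).2.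
Proof.
elim: i b => [b|i IH b]; first by rewrite addn0.
rewrite addnS nodeS; set t := node s (k + i) n => hb; apply: IH; rewrite -/t.
have t0 : 0 < t.2 by exact: node_gt0.
have [_ h _] := child_radius (odd (n %/ 2 ^ (k + i))) t0.
have := child_center (odd (n %/ 2 ^ (k + i))) t0.
have := dist_triangle t.1 (child (odd (n %/ 2 ^ (k + i))) t).1 b.
by move: hb h; set z := child _ _; lra.
Qed.

Definition tree_seq (n : nat) : X := (node s n n).1.

Lemma tree_seq_ball k n : (k <= n)%N ->
  dist (node s k n).1 (tree_seq n) < (node s k n).2.
Proof.
move=> kn; apply: (@node_ball k (n - k)).
by rewrite subnKC// dist_xx node_gt0.
Qed.

Lemma node0_center k : (node s k 0).1 = s.1.
Proof. by elim: k => //= k; rewrite div0n. Qed.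

(** The all-zero branch never moves the centre, while the radii shrink to 0. *)
Lemma tree_seq_root U : nbhs s.1 U ->
  exists K, forall n, (K <= n)%N -> n = 0 %[mod 2 ^ K] -> U (tree_seq n).
Proof.
move=> /nbhs_distP[r r0 rU].
have [K /(_ K (leqnn K)) Kr] := natSinv_lt r0.
exists K => n Kn n0; apply: rU; have := tree_seq_ball Kn.
rewrite (node_mod _ n0) node0_center => /lt_le_trans; apply.
exact: le_trans (node_radius _ _) (ltW Kr).
Qed.

(* At depth [K+1] the two children of the node found at depth [K] are so far
   apart that a small ball around [l] meets at most one of them. *)
Lemma tree_seq_residue l K : exists (r : nat) U, nbhs l U /\
  forall n, (K <= n)%N -> U (tree_seq n) -> n = r %[mod 2 ^ K].
Proof.
elim: K => [|K [r [U [lU Ur]]]].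
  by exists 0%N, setT; split; [exact: filterT|move=> n _ _; rewrite !modn1].
set t := node s K r; have t0 : 0 < t.2 by exact: node_gt0.
pose V := U `&` [set b | dist l b < dist t.1 (sibling t) / 4].
have lV : nbhs l V.
  apply: filterI => //; apply/nbhs_distP; exists (dist t.1 (sibling t) / 4) => //.
  by have /andP[] := siblingP t0; lra.
have Vn n : (K < n)%N -> V (tree_seq n) -> n = r %[mod 2 ^ K] /\
    dist (child (odd (n %/ 2 ^ K)) t).1 (tree_seq n) < dist t.1 (sibling t) / 4.
  move=> Kn [Un _]; have nr := Ur n (ltnW Kn) Un; split=> //.
  have := tree_seq_ball Kn; rewrite nodeS (node_mod _ nr) -/t => /lt_le_trans; apply.
  by have [] := child_radius (odd (n %/ 2 ^ K)) t0.
have same n n' : (K < n)%N -> (K < n')%N -> V (tree_seq n) -> V (tree_seq n') ->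
    odd (n %/ 2 ^ K) = odd (n' %/ 2 ^ K).
  wlog : n n' / odd (n %/ 2 ^ K) && ~~ odd (n' %/ 2 ^ K).
    move=> wl Kn Kn' Vn_ Vn'.
    case E : (odd (n %/ 2 ^ K)); case E' : (odd (n' %/ 2 ^ K)) => //.
      by rewrite -E -E'; apply: wl => //; rewrite E E'.
    by rewrite -E -E'; apply/esym; apply: wl => //; rewrite E E'.
  move=> /andP[on /negbTE on'] Kn Kn' Vn_ Vn'.
  have [_ ] := Vn _ Kn Vn_; have [_ ] := Vn _ Kn' Vn'; rewrite on on' /=.
  case: Vn_ => _ /=; case: Vn' => _ /= ln' ln tn' tn.
  have /andP[t1 _] := siblingP t0.
  (* The chain [t.1], [tree_seq n'], [l], [tree_seq n], [sibling t] has four steps, each below a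
     quarter of the distance between its ends. *)
  have := dist_triangle t.1 (tree_seq n') (sibling t).
  have := dist_triangle (tree_seq n') l (sibling t).
  have := dist_triangle l (tree_seq n) (sibling t).
  rewrite (distC (tree_seq n') l) (distC (tree_seq n) (sibling t)).
  move: t1 tn tn' ln ln'; lra.
(* All late visits to [V] share their lowest [K] bits and bit [K], so any one of them names the
   residue; without visits any residue will do. *)
have [[n0 Kn0 Vn0]|noV] :=
  pselect (exists2 n, (K < n)%N & V (tree_seq n)); last first.
  by exists 0%N, V; split=> // n Kn Vn_; exfalso; apply: noV; exists n.
exists n0, V; split=> // n Kn Vn_.
have e := same _ _ Kn Kn0 Vn_ Vn0.
have [nr _] := Vn _ Kn Vn_; have [n0r _] := Vn _ Kn0 Vn0.
by rewrite !modn_exp2S e nr n0r.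
Qed.

End splitting_tree.

Lemma scattered_sequence V e :
  (forall c r, 0 < r -> exists2 c', 0 < dist c c' & dist c c' < r) ->
  open V -> V e ->
  exists y : nat -> X, [/\ forall m, V (y m),
    forall U, nbhs e U -> exists K, forall m, (K <= m)%N ->
      m = 0 %[mod 2 ^ K] -> U (y m) &
    forall l K, exists (r : nat) U, nbhs l U /\
      forall m, (K <= m)%N -> U (y m) -> m = r %[mod 2 ^ K]].
Proof.
move=> crowded oV Ve; have /nbhs_distP[r r0 rV] := open_nbhs_nbhs (conj oV Ve).
(* The cap 1 starts the bound 1/(k+1) on the radii at depth [k]. *)
pose s : X * R := (e, Num.min r 1).
have s0 : 0 < s.2 by rewrite lt_min r0 ltr01.
have s1 : s.2 <= 1 by rewrite ge_min lexx orbT.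
exists (tree_seq s); split=> [m|U|l K].
- apply: rV; apply: lt_le_trans (tree_seq_ball crowded s0 (leq0n m)) _.
  by rewrite ge_min lexx.
- exact: (tree_seq_root crowded s0 s1).
- exact: (tree_seq_residue crowded s0).
Qed.

End metric_sequences.

(** * Filling the classes, and the three limit sets of the result *)

Section assembly.
Context {R : realType} {X : metricType R}.
Variables (A B C : set X) (y : nat -> nat -> X) (c : nat -> X).
Hypotheses (AB : A `<=` B) (BC : B `<=` C) (clB : closed B) (clC : closed C).
Hypotheses (yB : forall j m, B (y j m)) (cC : forall k, C (c k)).
Hypothesis y_scattered : forall j l K, ~ A l -> exists r U, nbhs l U /\
  forall m, (K <= m)%N -> U (y j m) -> m = r %[mod 2 ^ K].
Hypothesis y_blocks : forall a, A a -> exists j, forall (r : R) N, 0 < r ->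
  exists2 k, (N <= k)%N &
    forall m, (2 ^ k <= m < 2 * 2 ^ k)%N -> dist a (y j m) < r.
Hypothesis y_residue : forall l U, B l -> ~ A l -> nbhs l U ->
  exists j K, forall m, (K <= m)%N -> m = 0 %[mod 2 ^ K] -> U (y j m).
Hypothesis c_dense : forall a, C a -> forall (r : R) N, 0 < r ->
  exists2 k, (N <= k)%N & dist a (c k) < r.

(* The powers of 2, where [m = 0], form a set of zero density: [c] contributes
   only ordinary limit points. *)
Definition assembled (n : nat) : X :=
  let j := logn 2 n in let m := (n %/ 2 ^ j.+1)%N in
  if m == 0%N then c j else y j m.

Lemma assembled_dyadic j m :
  assembled (dyadic j m) = if m == 0%N then c j else y j m.
Proof. by rewrite /assembled logn_dyadic divn_dyadic. Qed.

Lemma assembled_in n : C (assembled n).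
Proof. by rewrite /assembled; case: ifP => _; [exact: cC|exact/BC/yB]. Qed.

Lemma assembled_notin n : (0 < n)%N -> ~ B (assembled n) ->
  n = (2 ^ logn 2 n)%N.
Proof.
move=> n0; rewrite /assembled; case: ifP => [/eqP m0 _|_ /(_ (yB _ _))//].
by rewrite -[LHS](dyadicK n0) m0 /dyadic muln0.
Qed.

(** Along a subsequence converging to a point outside [A], the late indices of each class have [m]
    confined to one residue modulo 2^K, for every [K]. *)
Lemma stat_limit_assembled_sub : stat_limit_points R assembled `<=` A.
Proof.
move=> l [u [[u0 um] xul]]; apply: contra_notP => nAl.
apply: zero_density_split => j; apply: zero_density_approx => K.
have [r [U [lU Ur]]] := y_scattered j K nAl.
have [N _ NU] := xul _ lU.
(* Indices from [M] on come after [u N] and, in class [j], have [m > K], so that [m] is not 0. *)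
pose M := (u N + dyadic j K.+1)%N.
exists (dyadic j r), `I_M; split; first exact: (@zero_density_bounded _ _ M).
move=> _ [[i _ <-] /= lj]; case: (ltnP (u i) M) => uiM; [by left|right => /=].
have Ni : (N <= i)%N.
  rewrite leqNgt; apply/negP => /um; move: uiM; rewrite /M; lia.
have ui0 : (0 < u i)%N by apply: leq_trans uiM; rewrite addn_gt0 dyadic_gt0 orbT.
have := NU i Ni; rewrite /= -(dyadicK ui0) lj assembled_dyadic.
set m := (_ %/ _)%N.
have Km : (K < m)%N.
  rewrite ltnNge; apply/negP => mK; have : (dyadic j m < u i)%N.
    by apply: leq_trans uiM; rewrite ltn_addl// dyadic_mono.
  by rewrite /m -lj dyadicK// ltnn.
rewrite gtn_eqF; last exact: leq_ltn_trans Km.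
move=> /(Ur _ (ltnW Km)) mr.
by rewrite /dyadic -modnDml -modnMmr mr modnMmr modnDml.
Qed.

(* The dyadic block [2^k, 2^(k+1)) contains half of the integers below its right
   end, so infinitely many blocks never have zero density. *)
Lemma stat_limit_assembled_sup : A `<=` stat_limit_points R assembled.
Proof.
move=> a /y_blocks[j jA].
have [|k km kA] := @extract_increasing (fun i k =>
    forall m, (2 ^ k <= m < 2 * 2 ^ k)%N -> dist a (y j m) < i.+1%:R^-1).
  by move=> i N; apply: jA; rewrite invr_gt0 ltr0n.
pose T := [set n | exists i m, (2 ^ k i <= m < 2 * 2 ^ k i)%N /\ n = dyadic j m].
have kN N : (N <= 2 ^ k N)%N.
  exact: leq_trans (homo_ltn_ge_id km N) (ltnW (ltn_expl _ _)).
have [|u um uT] := @enum_infinite T.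
  move=> N; exists (dyadic j (2 ^ k N)); last first.
    by exists N, (2 ^ k N)%N; split=> //; have := expn_gt0 2 (k N); lia.
  apply: leq_trans (kN N) _; rewrite /dyadic.
  by have := expn_gt0 2 j.+1; nia.
have Tu i : T (u i) by rewrite -uT; exists i.
exists u; split.
- by split=> //; have [i [m [_ ->]]] := Tu 0%N; exact: dyadic_gt0.
- apply/cvg_ballP => r r0; have [N Nr] := natSinv_lt r0.
  (* Members of [T] from blocks before the [N]-th lie below this bound, whereas [u i >= i]. *)
  exists (dyadic j (2 * 2 ^ k N)) => // i /= iN; rewrite ball_dist /=.
  have [i' [m [mk uE]]] := Tu i.
  rewrite uE assembled_dyadic gtn_eqF; last first.
    by have := expn_gt0 2 (k i'); lia.
  apply: lt_trans (kA _ _ mk) (Nr _ _); rewrite leqNgt; apply/negP => i'N.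
  have mN : (m < 2 * 2 ^ k N)%N.
    have : (2 ^ k i' <= 2 ^ k N)%N by rewrite leq_exp2l// ltnW// km.
    by lia.
  have := leq_trans (leq_trans iN (homo_ltn_ge_id um i)) (eq_leq uE).
  by rewrite leqNgt dyadic_mono.
- rewrite uT; apply: (@not_zero_density _ _ (2 ^ j.+1) (2 ^ j)) => [|N].
    by rewrite expn_gt0 leq_exp2l/=.
  by exists (2 ^ k N)%N => // t tk; exists N, t.
Qed.

Lemma stat_limit_sub_cluster (x : nat -> X) :
  stat_limit_points R x `<=` stat_cluster_points R x.
Proof.
move=> l [u [[u0 um] xul nz]] U lU zU; apply: nz; have [N _ NU] := xul _ lU.
have zN : zero_density R `I_(u N) by exact: (@zero_density_bounded _ _ (u N)).
apply: zero_densityS (zero_densityU zN zU).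
move=> n + [i _ uiE]; rewrite -uiE => ui0.
case: (ltnP (u i) (u N)) => uiN; [by left|right; split=> //].
by apply: NU => /=; rewrite leqNgt; apply/negP => /um; rewrite ltnNge uiN.
Qed.

(** Values outside [B] occur only at powers of 2, one in each class. A point of [B] outside [A] is
    approached along the progression m = 2^K t of some class. *)
Lemma stat_cluster_assembled : stat_cluster_points R assembled = B.
Proof.
apply/seteqP; split=> l.
- apply: contraPP => nBl /(_ (~` B)); apply.
    by apply: open_nbhs_nbhs; split=> //; exact: closed_openC.
  apply: zero_density_split => j; apply: (@zero_density_bounded _ _ (2 ^ j).+1).
  by move=> n [[n0 nB] /= <-]; rewrite {1}(assembled_notin n0 nB).
- move=> Bl; have [/stat_limit_assembled_sup|nAl] := pselect (A l).
    exact: stat_limit_sub_cluster.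
  move=> U lU; have [j [K KU]] := y_residue Bl nAl lU.
  apply: (@not_zero_density _ _ (2 ^ j.+1 * 2 ^ K) (2 ^ j)) => [|N].
    by rewrite expn_gt0 -expnD leq_exp2l//; lia.
  (* This makes [2 ^ K * t] nonzero and at least [K]. *)
  exists (N + K).+1 => [|t tK]; first by lia.
  have -> : (2 ^ j.+1 * 2 ^ K * t + 2 ^ j = dyadic j (2 ^ K * t))%N.
    by rewrite /dyadic mulnA.
  rewrite /= assembled_dyadic.
  split; first exact: dyadic_gt0.
  have K0 := expn_gt0 2 K; rewrite gtn_eqF; last by nia.
  by apply: KU; [nia|rewrite modnMr mod0n].
Qed.

Lemma limit_points_assembled : limit_points assembled = C.
Proof.
apply/seteqP; split=> [l [u [_ xul]]|l Cl].
  apply: (@closed_cvg _ _ _ _ _ C clC _ _ xul).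
  by near=> n; exact: assembled_in.
have [|k km kC] := @extract_increasing (fun i k => dist l (c k) < i.+1%:R^-1).
  by move=> i N; apply: c_dense => //; rewrite invr_gt0 ltr0n.
have xk i : assembled (2 ^ k i)%N = c (k i).
  by have := assembled_dyadic (k i) 0; rewrite /dyadic muln0.
exists (fun i => 2 ^ k i)%N; split.
  by split=> [|i j /km ij]; rewrite ?expn_gt0// ltn_exp2l.
by apply: cvg_dist_lt => i; have := kC i; rewrite -xk.
Unshelve. all: end_near. Qed.

End assembly.

(** * The construction under purely topological hypotheses *)

Lemma limit_sets_exist (R : realType) (X : metricType R) (A B C V : set X) :
  separable X ->
  (forall (e : X) (r : R), 0 < r -> exists2 e', 0 < dist e e' & dist e e' < r) ->
  A `<=` B -> B `<=` C -> Fsigma A -> closed B -> closed C ->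
  open V -> V !=set0 -> V `<=` B -> B `\` A `<=` closure V ->
  exists x : nat -> X,
    [/\ stat_limit_points R x = A, stat_cluster_points R x = B &
        limit_points x = C].
Proof.
move=> sepX crowded AB BC [F clF AF] clB clC oV V0 VB BAV.
have [e [eV eD]] := frequently_dense_sequence sepX V0.
have [z zP] := choice (fun i => scattered_sequence crowded oV (eV i)).
have [c [cC cD]] : exists c : nat -> X, (forall k, C (c k)) /\
    forall a, C a -> forall (r : R) N, 0 < r ->
      exists2 k, (N <= k)%N & dist a (c k) < r.
  by apply: frequently_dense_sequence => //; have [v /VB/BC] := V0; exists v.
have : forall i, exists w : nat -> X, [/\ forall m, B (w m),
    forall l K, ~ A l -> exists r U, nbhs l U /\
      forall m, (K <= m)%N -> U (w m) -> m = r %[mod 2 ^ K] &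
    forall a, F i a -> forall (r : R) N, 0 < r -> exists2 k, (N <= k)%N &
      forall m, (2 ^ k <= m < 2 * 2 ^ k)%N -> dist a (w m) < r].
  move=> i; have [F0|] := pselect (F i !=set0); last first.
    (* With [F i] empty there is nothing to approximate, and a scattered sequence in [B] fills the
       class. *)
    move=> /nonemptyPn F0; exists (z 0%N); have [zV _ zr] := zP 0%N; split.
    - by move=> m; exact/VB/zV.
    - by move=> l K _; exact: zr.
    - by move=> a; rewrite F0.
  have [q [qF qD]] := frequently_dense_sequence sepX F0.
  have FA : F i `<=` A by rewrite AF; exact: bigcup_sup.
  exists (fun m => q (trunc_log 2 m)); split.
  - by move=> m; exact/AB/FA.
  (* The complement of [F i] is a neighborhood of [l] that is never visited, so the residue 0 is
     arbitrary. *)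
  - move=> l K nAl; exists 0%N, (~` F i); split; last by move=> m _ /(_ (qF _)).
    apply: open_nbhs_nbhs; split; first exact: closed_openC.
    by move=> /FA.
  - move=> a Fa r N r0; have [k Nk ka] := qD a Fa r N r0; exists k => // m mk.
    by rewrite (@trunc_log_eq 2 k m)// expnS.
move=> /choice[w wP].
(* Odd classes carry the scattered sequences, even ones the block sequences. *)
pose y j := if odd j then z j./2 else w j./2.
exists (assembled y c).
have yB j m : B (y j m).
  rewrite /y; case: (odd j); first by apply: VB; have [] := zP j./2.
  by have [] := wP j./2.
have y_scattered j l K : ~ A l -> exists r U, nbhs l U /\
    forall m, (K <= m)%N -> U (y j m) -> m = r %[mod 2 ^ K].
  rewrite /y; case: (odd j); first by have [_ _ zr _] := zP j./2; exact: zr.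
  by have [_ wr _] := wP j./2; exact: wr.
have y_blocks a : A a -> exists j, forall (r : R) N, 0 < r ->
    exists2 k, (N <= k)%N &
      forall m, (2 ^ k <= m < 2 * 2 ^ k)%N -> dist a (y j m) < r.
  rewrite AF => -[i _ Fa]; exists i.*2; rewrite /y odd_double doubleK.
  by have [_ _] := wP i; exact.
have y_residue l U : B l -> ~ A l -> nbhs l U ->
    exists j K, forall m, (K <= m)%N -> m = 0 %[mod 2 ^ K] -> U (y j m).
  (* The interior of [U] meets [V], hence contains some [e i], to which a residue class of [z i]
     stays close. *)
  move=> Bl nAl lU; have clVl : closure V l by exact: BAV.
  have [b [Vb Ub]] := clVl _ (nbhs_interior lU).
  have /nbhs_distP[r r0 rU] : nbhs b U° by exact: nbhs_interior.
  have [i _ /rU Ui] := eD b Vb r 0%N r0.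
  have [_ zr _] := zP i; have [K KU] := zr _ Ui.
  by exists i.*2.+1, K; rewrite /y /= odd_double /= uphalf_double.
split.
- apply/seteqP; split; first exact: stat_limit_assembled_sub.
  exact: stat_limit_assembled_sup.
- exact: (@stat_cluster_assembled _ _ A).
- exact: (@limit_points_assembled _ _ B).
Qed.

(** * From the measure to the topological hypotheses *)

Lemma atomless_set1 (d : measure_display) (T : measurableType d)
    (R : realType) (mu : {measure set T -> \bar R}) (a : T) :
  measurable [set a] -> atomless mu -> mu [set a] = 0%E.
Proof.
move=> ma amu; apply/eqP; rewrite eq_le measure_ge0 andbT leNgt; apply/negP => a0.
have [E' [_ + /andP[E'0 E'a]]] := amu _ ma a0.
move=> /subset_set1[E'E|E'E]; first by rewrite E'E measure0 ltxx in E'0.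
by rewrite E'E ltxx in E'a.
Qed.

Theorem theorem3p1 (R : realType) (X : pmetricType R)
    (mu : probability (borel X) R) (A B C : set X) :
  separable X -> atomless mu -> strictly_positive mu ->
  A `<=` B -> B `<=` C -> Fsigma A -> closed B -> closed C ->
  (0 < mu B)%E ->
  isolated B `<=` A ->
  regclosed (B `\` isolated B) ->
  exists x : nat -> X,
    [/\ stat_limit_points R x = A, stat_cluster_points R x = B &
        limit_points x = C].
Proof.
move=> sepX amu posmu AB BC FA clB clC muB isoA regB.
have mcl (D : set X) : closed D -> measurable (D : set (borel X)).
  move=> clD; rewrite -[D]setCK; apply: measurableC.
  by apply: sub_sigma_algebra; exact: closed_openC.
have m1 (a : X) : measurable ([set a] : set (borel X)).
  apply: mcl; apply: accessible_closed_set1; apply: hausdorff_accessible.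
  exact: (@metric_hausdorff R X).
have mu1 (a : X) : mu [set a] = 0%E by exact: atomless_set1.
have crowded (a : X) (r : R) : 0 < r -> exists2 b, 0 < dist a b & dist a b < r.
  (* Otherwise the interior of the ball is the null set [[set a]], nonempty and open. *)
  move=> r0; apply: contrapT => nb.
  have /posmu : (ball a r)° !=set0.
    by exists a; apply: nbhs_singleton; exact/nbhs_interior/nbhsx_ballx.
  move=> /(_ (open_interior _)); rewrite (_ : _° = [set a]) ?mu1 ?ltxx//.
  apply/seteqP; split=> [b /interior_subset|_ ->].
    rewrite ball_dist /= => ab; apply/esym/eqP; apply/negPn/negP => nab.
    by apply: nb; exists b => //; rewrite /dist mdist_gt0.
  by apply: nbhs_singleton; exact/nbhs_interior/nbhsx_ballx.
have B0 : B !=set0.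
  by apply/set0P/eqP => B0; rewrite B0 measure0 ltxx in muB.
have V0 : (B `\` isolated B)° !=set0.
  (* With empty interior, regularity makes every point of [B] isolated. A dense sequence of [B] hits
     each of them, so countably many null singletons cover [B]. *)
  apply/set0P/eqP => V0; move: regB; rewrite /regclosed V0 closure0.
  move=> /esym; rewrite setD_eq0 => Biso.
  have [q [qB qD]] := frequently_dense_sequence sepX B0.
  have : (mu B <= \sum_(0 <= k <oo) mu [set q k])%E.
    apply: measure_sigma_subadditive => //; first exact: mcl.
    move=> b Bb; have [_ [U /nbhs_distP[r r0 rU] UB]] := Biso b Bb.
    have [k _ bk] := qD b Bb r 0%N r0.
    exists k => //; have : (U `&` B) (q k) by split; [exact: rU|exact: qB].
    by rewrite UB => ->.
  rewrite eseries0 => [|k _ _]; last exact: mu1.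
  by rewrite leNgt muB.
apply: (@limit_sets_exist R X A B C (B `\` isolated B)°) => //.
- exact: open_interior.
- by move=> b /interior_subset[].
- by move=> b [Bb nAb]; rewrite regB; split=> // /isoA.
Qed.
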